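(* The system $\mathsf{K45}_n^L$ is sound and complete with respect to the class $\mathcal{H}_n^{su}$ of all simple and $n$-uniform hypergraph models, and the system $\mathsf{KD45}_n^L$ is sound and complete with respect to the class $\mathcal{H}_n^{sut}$ of all simple, $n$-uniform and tail-complete hypergraph models. That is, for every formula $\varphi\in\mathcal{L}_B$: (1) $\mathsf{K45}_n^L\vdash\varphi$ if and only if $\varphi$ is valid in $\mathcal{H}_n^{su}$; and (2) $\mathsf{KD45}_n^L\vdash\varphi$ if and only if $\varphi$ is valid in $\mathcal{H}_n^{sut}$. Here $\varphi$ is valid in a class $\mathcal{C}$ of hypergraph models if $M,E\models\varphi$ for every $M=(G,\chi,\ell)\in\mathcal{C}$ and every hyperedge $E$ of $G$.
   Context: Agents and language. Fix a set $\mathcal{A}$ of $n\geq 1$ agents (finite, $|\mathcal{A}|=n$). Each $a\in\mathcal{A}$ has a countable set $\mathsf{Var}_a$ of propositional letters (the local variables of $a$); these sets are pairwise disjoint, and $\mathsf{Var}:=\bigcup_{a\in\mathcal{A}}\mathsf{Var}_a$. The language $\mathcal{L}_B$ is generated by $\varphi::=p\mid\neg\varphi\mid\varphi\wedge\varphi\mid B_a\varphi$ with $p\in\mathsf{Var}$, $a\in\mathcal{A}$. Put $\varphi\vee\psi:=\neg(\neg\varphi\wedge\neg\psi)$, $\varphi\to\psi:=\neg\varphi\vee\psi$. Proof systems. $\mathsf{KD45}_n^L$ has as axioms all instances of classical tautologies, and all instances (for all $a\in\mathcal{A}$, $\varphi,\psi\in\mathcal{L}_B$) of: (K) $B_a(\varphi\to\psi)\to(B_a\varphi\to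 B_a\psi)$; (D) $\neg B_a(\varphi\wedge\neg\varphi)$; (4) $B_a\varphi\to B_aB_a\varphi$; (5) $\neg B_a\varphi\to B_a\neg B_a\varphi$; (Loc) $(p\to B_ap)\wedge(\neg p\to B_a\neg p)$ for $p\in\mathsf{Var}_a$. Rules: modus ponens (from $\varphi$ and $\varphi\to\psi$ infer $\psi$) and necessitation (from $\varphi$ infer $B_a\varphi$). $\mathsf{K45}_n^L$ is obtained from $\mathsf{KD45}_n^L$ by omitting the axiom scheme (D). $\vdash\varphi$ means there is a finite sequence of formulas ending with $\varphi$, each an axiom or obtained from earlier ones by a rule. Hypergraphs. A directed hyperedge over a set $\mathscr{V}$ is a pair $E=(X,Y)$ of finite disjoint (possibly empty) subsets of $\mathscr{V}$; $T(E):=X$ (tail), $H(E):=Y$ (head), $U(E):=T(E)\cup H(E)$. A directed hypergraph is a pair $G=(\mathscr{V}(G),\mathscr{E}(G))$ with $\mathscr{V}(G)$ a non-empty set of vertices and $\mathscr{E}(G)$ a set of directed hyperedges over $\mathscr{V}(G)$. $G$ is simple if for all $E_1,E_2\in\mathscr{E}(G)$, $E_1\neq E_2$ implies $U(E_1)\not\subseteq U(E_2)$; $k$-uniform if $|U(E)|=k$ for all $E\in\mathscr{E}(G)$; tail-complete if $\mathscr{V}(G)=\bigcup_{E\in\mathscr{E}(G)}T(E)$. A coloring of $G$ is a map $\chi:\mathscr{V}(G)\to\mathcal{A}$ such that for every $E\in\mathscr{E}(G)$ and all distinct $u,v\in U(E)$, $\chi(u)\neq\chi(v)$. A hypergraph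 model is a triple $M=(G,\chi,\ell)$ with $G$ a directed hypergraph, $\chi$ a coloring of $G$, and $\ell:\mathscr{V}(G)\to\mathcal{P}(\mathsf{Var})$ such that $\chi(u)=a$ implies $\ell(u)\subseteq\mathsf{Var}_a$. It is simple ($n$-uniform, tail-complete) if $G$ is. For $E\in\mathscr{E}(G)$ put $\ell(E):=\bigcup_{u\in U(E)}\ell(u)$. Semantics. For $a\in\mathcal{A}$ and $E_1,E_2\in\mathscr{E}(G)$: $E_1\vartriangleright_aE_2$ iff some $u\in U(E_1)\cap T(E_2)$ has $\chi(u)=a$. Satisfaction: $M,E\models p$ iff $p\in\ell(E)$; $\neg,\wedge$ as usual; $M,E\models B_a\varphi$ iff $M,E'\models\varphi$ for all $E'\in\mathscr{E}(G)$ with $E\vartriangleright_aE'$. *)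

(* Defs.v *)
From Stdlib Require List.
From mathcomp Require Import all_boot.
From mathcomp Require Import finmap classical_sets.

Set Implicit Arguments.
Unset Strict Implicit.
Unset Printing Implicit Defensive.

Local Open Scope classical_set_scope.

(* The letters local to the agent [a] are the elements of [Var a]; tagging them
   with their agent makes the sets of local letters pairwise disjoint. *)
Definition letter (A : finType) (Var : A -> countType) : Type := {a : A & Var a}.

Definition local_letters (A : finType) (Var : A -> countType) (a : A) :
  set (letter Var) := [set p | tag p = a].

Inductive formula (A : finType) (Var : A -> countType) : Type :=
| FVar of letter Var
| FNot of formula Var
| FAnd of formula Var & formula Var
| FB of A & formula Var.

Arguments FVar {A Var} _.
Arguments FNot {A Var} _.
Arguments FAnd {A Var} _ _.
Arguments FB {A Var} _ _.

Definition FOr (A : finType) (Var : A -> countType) (phi psi : formula Var) :=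
  FNot (FAnd (FNot phi) (FNot psi)).

Definition FImp (A : finType) (Var : A -> countType) (phi psi : formula Var) :=
  FOr (FNot phi) psi.

(* The axiom scheme of classical tautologies consists of the substitution
   instances in [formula Var] of the tautologies of this language. *)
Inductive prop_formula : Type :=
| PVar of nat
| PNot of prop_formula
| PAnd of prop_formula & prop_formula.

Fixpoint prop_eval (v : nat -> bool) (t : prop_formula) : bool :=
  match t with
  | PVar i => v i
  | PNot t1 => ~~ prop_eval v t1
  | PAnd t1 t2 => prop_eval v t1 && prop_eval v t2
  end.

Definition tautology (t : prop_formula) : Prop := forall v, prop_eval v t.

Fixpoint prop_subst (A : finType) (Var : A -> countType)
    (sigma : nat -> formula Var) (t : prop_formula) : formula Var :=
  match t with
  | PVar i => sigma i
  | PNot t1 => FNot (prop_subst sigma t1)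
  | PAnd t1 t2 => FAnd (prop_subst sigma t1) (prop_subst sigma t2)
  end.

Inductive K45L_axiom (A : finType) (Var : A -> countType) : formula Var -> Prop :=
| ax_taut t sigma : tautology t -> K45L_axiom (prop_subst sigma t)
| ax_K a phi psi :
    K45L_axiom (FImp (FB a (FImp phi psi)) (FImp (FB a phi) (FB a psi)))
| ax_4 a phi : K45L_axiom (FImp (FB a phi) (FB a (FB a phi)))
| ax_5 a phi : K45L_axiom (FImp (FNot (FB a phi)) (FB a (FNot (FB a phi))))
| ax_Loc a p : local_letters a p ->
    K45L_axiom (FAnd (FImp (FVar p) (FB a (FVar p)))
                     (FImp (FNot (FVar p)) (FB a (FNot (FVar p))))).

Inductive KD45L_axiom (A : finType) (Var : A -> countType) : formula Var -> Prop :=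
| ax_K45L phi : K45L_axiom phi -> KD45L_axiom phi
| ax_D a phi : KD45L_axiom (FNot (FB a (FAnd phi (FNot phi)))).

Definition by_rule (A : finType) (Var : A -> countType)
    (s : seq (formula Var)) (psi : formula Var) : Prop :=
  (exists phi, List.In phi s /\ List.In (FImp phi psi) s) \/
  (exists a phi, List.In phi s /\ psi = FB a phi).

Definition derivation (A : finType) (Var : A -> countType)
    (Ax : formula Var -> Prop) (s : seq (formula Var)) : Prop :=
  forall s1 psi s2, s = s1 ++ psi :: s2 -> Ax psi \/ by_rule s1 psi.

Definition provable (A : finType) (Var : A -> countType)
    (Ax : formula Var -> Prop) (phi : formula Var) : Prop :=
  exists s, derivation Ax (rcons s phi).

Record hyperedge (V : choiceType) : Type := Hyperedge {
  tail : {fset V};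
  head : {fset V};
  tail_head_disjoint : fdisjoint tail head
}.

Definition support (V : choiceType) (E : hyperedge V) : {fset V} :=
  (tail E `|` head E)%fset.

(* Classically every type carries a choiceType structure, so [vertex] is an
   arbitrary non-empty set; [choiceType] is only what {fset _} requires. *)
Record hypergraph : Type := Hypergraph {
  vertex : choiceType;
  vertex_nonempty : inhabited vertex;
  edges : set (hyperedge vertex)
}.

Definition simple (G : hypergraph) : Prop :=
  forall E1 E2 : hyperedge (vertex G), edges E1 -> edges E2 ->
    E1 <> E2 -> ~ (support E1 `<=` support E2)%fset.

Definition uniform (k : nat) (G : hypergraph) : Prop :=
  forall E : hyperedge (vertex G), edges E -> #|` support E| = k.

Definition tail_complete (G : hypergraph) : Prop :=
  [set: vertex G] = \bigcup_(E in @edges G) [set` tail E].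

Definition coloring (A : finType) (G : hypergraph) (chi : vertex G -> A) : Prop :=
  forall E : hyperedge (vertex G), edges E ->
    forall u v, u \in support E -> v \in support E -> u <> v -> chi u <> chi v.

Record model (A : finType) (Var : A -> countType) : Type := Model {
  graph : hypergraph;
  color : vertex graph -> A;
  label : vertex graph -> set (letter Var);
  colorP : coloring color;
  labelP : forall u a, color u = a -> label u `<=` local_letters a
}.

Definition edge_label (A : finType) (Var : A -> countType) (M : model Var)
    (E : hyperedge (vertex (graph M))) : set (letter Var) :=
  \bigcup_(u in [set` support E]) label u.

Definition accessible (A : finType) (Var : A -> countType) (M : model Var)
    (a : A) (E1 E2 : hyperedge (vertex (graph M))) : Prop :=
  exists2 u, u \in (support E1 `&` tail E2)%fset & color u = a.

Fixpoint sat (A : finType) (Var : A -> countType) (M : model Var)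
    (E : hyperedge (vertex (graph M))) (phi : formula Var) : Prop :=
  match phi with
  | FVar p => edge_label E p
  | FNot phi1 => ~ sat E phi1
  | FAnd phi1 phi2 => sat E phi1 /\ sat E phi2
  | FB a phi1 => forall E' : hyperedge (vertex (graph M)),
      edges E' -> accessible a E E' -> sat E' phi1
  end.

Definition valid (A : finType) (Var : A -> countType)
    (C : model Var -> Prop) (phi : formula Var) : Prop :=
  forall M : model Var, C M ->
    forall E : hyperedge (vertex (graph M)), edges E -> sat E phi.

Definition Hsu (A : finType) (Var : A -> countType) (n : nat) (M : model Var) : Prop :=
  simple (graph M) /\ uniform n (graph M).

Definition Hsut (A : finType) (Var : A -> countType) (n : nat) (M : model Var) : Prop :=
  [/\ simple (graph M), uniform n (graph M) & tail_complete (graph M)].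

(* Main.v *)
From mathcomp Require Import all_boot.
From mathcomp Require Import finmap boolp classical_sets.
Require Import Defs.

(* In an n-uniform model with n agents every hyperedge has exactly one vertex of
   each color, so E |>_a E' holds iff the a-vertex of E lies in the tail of E';
   soundness follows.

   For completeness, the canonical Kripke model is turned directly into a
   hypergraph model. The a-vertex of a maximal consistent set w is the pair of a
   and the set of formulas of w that are letters of a or of the form B_a phi; it
   is a tail vertex iff w is R_a-related to itself. By (4), (5) and (Loc), w R_a w'
   holds iff w and w' share their a-vertex and w' R_a w', i.e. iff the hyperedge of
   w' is accessible from that of w. The hypergraph is simple because every letter
   belongs to some agent: the n vertices of w fix all letters and all formulas
   B_a phi of w, hence w. With (D), every a-vertex of some w is also that of an
   R_a-successor w', in whose hyperedge it lies in the tail. *)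

Set Implicit Arguments.
Unset Strict Implicit.
Unset Printing Implicit Defensive.

Local Open Scope classical_set_scope.

(** * Proof sequences and their inductive counterpart *)

Section Derivations.
Variables (A : finType) (Var : A -> countType) (Ax : formula Var -> Prop).

(** Derivability in tree form, which permits induction on proofs; [provableE] ties it to proof
    sequences. *)
Inductive thm : formula Var -> Prop :=
| thm_ax phi : Ax phi -> thm phi
| thm_mp phi psi : thm phi -> thm (FImp phi psi) -> thm psi
| thm_nec a phi : thm phi -> thm (FB a phi).

Lemma In_cat (T : Type) (x : T) s t :
  List.In x (s ++ t) <-> List.In x s \/ List.In x t.
Proof. by elim: s => [|y s IH] /=; tauto. Qed.

Lemma by_rule_sub s t psi : (forall x, List.In x s -> List.In x t) ->
  by_rule s psi -> @by_rule A Var t psi.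
Proof.
move=> st [[phi [h1 h2]]|[a [phi [h1 ->]]]].
  by left; exists phi; split; apply: st.
by right; exists a, phi; split; first exact: st.
Qed.

Lemma derivation_rcons s psi :
  derivation Ax (rcons s psi) <->
  derivation Ax s /\ (Ax psi \/ by_rule s psi).
Proof.
split=> [d|[d hpsi] s1 chi s2].
  split; last by apply: (d s psi [::]); rewrite cats1.
  by move=> s1 chi s2 es; apply: (d s1 chi (rcons s2 psi)); rewrite es rcons_cat.
case: (lastP s2) => [|s2' y].
  by rewrite cats1 => /rcons_inj [<- <-].
by rewrite -rcons_cons -rcons_cat => /rcons_inj [es _]; apply: d es.
Qed.

Lemma derivation_cat s t :
  derivation Ax s -> derivation Ax t -> derivation Ax (s ++ t).
Proof.
move=> ds; elim/last_ind: t => [|t psi IH]; first by rewrite cats0.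
rewrite -rcons_cat => /derivation_rcons [dt hpsi].
apply/derivation_rcons; split; first exact: IH.
case: hpsi => [|h]; [by left|right; apply: by_rule_sub h => x xt].
by apply/In_cat; right.
Qed.

Lemma provableE phi : provable Ax phi <-> thm phi.
Proof.
split=> [[s d]|].
  suff H t : derivation Ax t -> forall psi, List.In psi t -> thm psi.
    by apply: H d _ _; rewrite -cats1; apply/In_cat; right; left.
  elim/last_ind: t => [|t chi IH] // /derivation_rcons [dt hchi] psi.
  rewrite -cats1 => /In_cat [|[<-|//]]; first exact: IH.
  case: hchi => [|[[xi [h1 h2]]|[a [xi [h1 ->]]]]]; first exact: thm_ax.
    exact: (thm_mp (IH dt _ h1) (IH dt _ h2)).
  exact: thm_nec (IH dt _ h1).
have last_in (s : seq (formula Var)) x : List.In x (rcons s x).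
  by rewrite -cats1; apply/In_cat; right; left.
elim=> [{}phi ax|{}phi psi _ [s ds] _ [t dt]|a {}phi _ [s ds]].
- by exists [::]; apply/derivation_rcons; split; [case|left].
- exists (rcons s phi ++ rcons t (FImp phi psi)).
  apply/derivation_rcons; split; first exact: derivation_cat.
  by right; left; exists phi; split; apply/In_cat; [left|right].
- exists (rcons s phi); apply/derivation_rcons; split=> //.
  by right; right; exists a, phi.
Qed.

End Derivations.

(** * Entailment from hypotheses, Lindenbaum's lemma, maximal consistent sets *)

Section MaximalConsistentSets.
Variables (A : finType) (Var : A -> countType) (Ax : formula Var -> Prop).
Hypothesis K45L : forall phi, K45L_axiom phi -> Ax phi.

Notation thm := (thm Ax).

(** Necessitation enters only through [thm] and is never applied to hypotheses; this is what makes
    [deduction] hold. *)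
Inductive entails (S : set (formula Var)) : formula Var -> Prop :=
| ent_hyp phi : S phi -> entails S phi
| ent_thm phi : thm phi -> entails S phi
| ent_mp phi psi : entails S phi -> entails S (FImp phi psi) -> entails S psi.

(** Shaped so that [prop_subst] turns it into [FImp] by computation. *)
Definition PImp t1 t2 := PNot (PAnd (PNot (PNot t1)) (PNot t2)).

(** The default value [c] of [nth] serves as the third formula: every index from 2 on yields it. *)
Lemma thm_taut3 (a b c : formula Var) t : tautology t ->
  thm (prop_subst (fun i => nth c [:: a; b] i) t).
Proof. by move=> ht; apply/thm_ax/K45L/ax_taut. Qed.

Ltac taut t a b c :=
  let v := fresh "v" in
  refine (@thm_taut3 a b c t _) => v /=;
  by case: (v 0); case: (v 1); case: (v 2).

Local Notation P0 := (PVar 0).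
Local Notation P1 := (PVar 1).
Local Notation P2 := (PVar 2).

Lemma thm_refl a : thm (FImp a a).
Proof. by taut (PImp P0 P0) a a a. Qed.

Lemma thm_const a b : thm (FImp a (FImp b a)).
Proof. by taut (PImp P0 (PImp P1 P0)) a b a. Qed.

Lemma thm_distr a b c :
  thm (FImp (FImp a (FImp b c)) (FImp (FImp a b) (FImp a c))).
Proof.
by taut (PImp (PImp P0 (PImp P1 P2)) (PImp (PImp P0 P1) (PImp P0 P2))) a b c.
Qed.

Lemma thm_exfalso a b : thm (FImp a (FImp (FNot a) b)).
Proof. by taut (PImp P0 (PImp (PNot P0) P1)) a b a. Qed.

Lemma thm_cases a b : thm (FImp (FImp a b) (FImp (FImp (FNot a) b) b)).
Proof.
by taut (PImp (PImp P0 P1) (PImp (PImp (PNot P0) P1) P1)) a b a.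
Qed.

Lemma thm_pair a b : thm (FImp a (FImp b (FAnd a b))).
Proof. by taut (PImp P0 (PImp P1 (PAnd P0 P1))) a b a. Qed.

Lemma thm_fst a b : thm (FImp (FAnd a b) a).
Proof. by taut (PImp (PAnd P0 P1) P0) a b a. Qed.

Lemma thm_snd a b : thm (FImp (FAnd a b) b).
Proof. by taut (PImp (PAnd P0 P1) P1) a b a. Qed.

Lemma ent_mp_thm S phi psi : thm (FImp phi psi) -> entails S phi -> entails S psi.
Proof. by move=> h1 h2; apply: ent_mp h2 (ent_thm _ h1). Qed.

Lemma ent_mono S S' phi : S `<=` S' -> entails S phi -> entails S' phi.
Proof.
move=> SS'; elim=> [psi /SS'|psi|psi chi _ h1 _ h2].
- exact: ent_hyp.
- exact: ent_thm.
- exact: ent_mp h1 h2.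
Qed.

Lemma deduction S phi psi :
  entails (S `|` [set phi]) psi -> entails S (FImp phi psi).
Proof.
elim=> [chi [Schi|->]|chi hchi|chi xi _ h1 _ h2].
- exact: ent_mp_thm (thm_const _ _) (ent_hyp Schi).
- exact: ent_thm (thm_refl _).
- exact: ent_mp_thm (thm_const _ _) (ent_thm _ hchi).
- exact: ent_mp h1 (ent_mp_thm (thm_distr _ _ _) h2).
Qed.

Lemma ent_set0 phi : entails set0 phi -> thm phi.
Proof. by elim=> [psi []|//|psi chi _ h1 _ h2]; apply: thm_mp h1 h2. Qed.

(** At a modus ponens, the larger of the two members used for the premises serves for both. The
    first disjunct covers the empty chain. *)
Lemma ent_chain S (F : set (set (formula Var))) phi :
  total_on F subset -> entails (S `|` \bigcup_(X in F) X) phi ->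
  entails S phi \/ exists2 X, F X & entails (S `|` X) phi.
Proof.
move=> tF; have up X Y psi : X `<=` Y -> entails (S `|` X) psi ->
    entails (S `|` Y) psi by move=> XY; apply: ent_mono; apply: setUS.
have up0 X psi : entails S psi -> entails (S `|` X) psi.
  by apply: ent_mono; apply: subsetUl.
elim=> [psi [Spsi|[X FX Xpsi]]|psi hpsi|psi chi _ h1 _ h2].
- by left; apply: ent_hyp.
- by right; exists X => //; apply: ent_hyp; right.
- by left; apply: ent_thm.
case: h1 h2 => [h1|[X FX h1]] [h2|[Y FY h2]].
- by left; apply: ent_mp h1 h2.
- by right; exists Y => //; apply: ent_mp (up0 _ _ h1) h2.
- by right; exists X => //; apply: ent_mp h1 (up0 _ _ h2).
- right; case: (tF X Y FX FY) => XY.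
    by exists Y => //; apply: ent_mp (up _ _ _ XY h1) h2.
  by exists X => //; apply: ent_mp h1 (up _ _ _ XY h2).
Qed.

(** Maximality takes the form of negation completeness instead of maximality under inclusion; the
    same equivalence gives consistency. *)
Definition maximal_consistent (w : set (formula Var)) : Prop :=
  (forall phi, entails w phi -> w phi) /\ (forall phi, w (FNot phi) <-> ~ w phi).

Lemma lindenbaum S phi : ~ entails S phi ->
  exists w, [/\ maximal_consistent w, S `<=` w & ~ w phi].
Proof.
(* [P] collects sets of extra hypotheses rather than supersets of [S], so that the union of the
   empty chain lies in it by [nS]. *)
move=> nS; pose P := [set X | ~ entails (S `|` X) phi].
have [|X [PX maxX]] := @Zorn_bigcup _ P.
  by move=> F FP tF /(ent_chain tF) [//|[X FX]]; apply: FP.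
pose w := S `|` X.
have wmax psi : ~ w psi -> entails (w `|` [set psi]) phi.
  move=> nw; apply: contrapT => nent.
  apply: (maxX (X `|` [set psi])); last by rewrite /P /= setUA.
  split; first exact: subsetUl.
  by move=> /(_ psi (or_intror erefl)) Xpsi; apply: nw; right.
have wcl psi : entails w psi -> w psi.
  move=> wpsi; apply: contrapT => /wmax /deduction h.
  exact: PX (ent_mp wpsi h).
have nw : ~ w phi by move=> h; apply: PX; apply: ent_hyp.
exists w; split=> //; last exact: subsetUl.
split=> // psi; split=> [wn wpsi|wpsi].
  apply: PX; apply: ent_mp (ent_hyp wn) _.
  exact: ent_mp_thm (thm_exfalso _ _) (ent_hyp wpsi).
(* With neither [psi] nor its negation in [w], adding either one would entail [phi], so [w] alone
   would, by case distinction. *)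
apply: contrapT => wn; apply: PX.
apply: ent_mp (deduction (wmax _ wn)) _.
exact: ent_mp_thm (thm_cases _ _) (deduction (wmax _ wpsi)).
Qed.

Section MaximalConsistentSet.
Variables (w : set (formula Var)) (wP : maximal_consistent w).

Lemma mc_not phi : w (FNot phi) <-> ~ w phi.
Proof. exact: wP.2. Qed.

Lemma mc_thm phi : thm phi -> w phi.
Proof. by move=> h; apply: wP.1; apply: ent_thm. Qed.

Lemma mc_mp phi psi : w (FImp phi psi) -> w phi -> w psi.
Proof.
by move=> h1 h2; apply: wP.1; apply: ent_mp (ent_hyp h2) (ent_hyp h1).
Qed.

Lemma mc_and phi psi : w (FAnd phi psi) <-> w phi /\ w psi.
Proof.
split=> [h|[h1 h2]].
  by split; apply: mc_mp h; apply: mc_thm; [apply: thm_fst|apply: thm_snd].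
by apply: mc_mp h2; apply: mc_mp h1; apply: mc_thm; apply: thm_pair.
Qed.

(** By necessitation and (K), whatever follows from the formulas boxed in [w] is itself boxed in
    [w]. Hence if [FB a psi] is missing, these formulas extend to a maximal consistent set without
    [psi]. *)
Lemma mc_box a psi :
  w (FB a psi) <-> forall w', maximal_consistent w' ->
    (forall chi, w (FB a chi) -> w' chi) -> w' psi.
Proof.
split=> [h w' _|H]; first exact.
apply: contrapT => nB.
have boxed chi : entails [set chi | w (FB a chi)] chi -> w (FB a chi).
  elim=> [//|xi hxi|xi xi' _ h1 _ h2].
    by apply: mc_thm; apply: thm_nec.
  apply: mc_mp h1; apply: mc_mp h2.
  by apply: mc_thm; apply/thm_ax/K45L/ax_K.
have [//|w' [mw' sub nw']] := @lindenbaum [set chi | w (FB a chi)] psi.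
  by move/boxed.
exact: nw' (H w' mw' sub).
Qed.

End MaximalConsistentSet.

End MaximalConsistentSets.

(** * The canonical hypergraph model and completeness *)

Section CanonicalModel.
Variables (A : finType) (Var : A -> countType) (Ax : formula Var -> Prop).
Hypothesis K45L : forall phi, K45L_axiom phi -> Ax phi.

Notation mc := (maximal_consistent Ax).

Definition local_formula (a : A) (phi : formula Var) : Prop :=
  match phi with
  | FVar p => tag p = a
  | FB b _ => b = a
  | _ => False
  end.

Definition view (a : A) (w : set (formula Var)) : set (formula Var) :=
  w `&` local_formula a.

Definition canonical_rel (a : A) (w w' : set (formula Var)) : Prop :=
  forall phi, w (FB a phi) -> w' phi.

Lemma canonical_rel_view a w w' : mc w -> mc w' ->
  canonical_rel a w w' <-> view a w = view a w' /\ canonical_rel a w' w'.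
Proof.
move=> mw mw'; split=> [R|[ev R] phi wB]; last first.
  by apply: R; have [] : view a w' (FB a phi) by rewrite -ev.
(* Used with (4) and (5) for boxed formulas and their negations, and with (Loc) for letters and
   theirs, so that membership transfers both ways. *)
have pull chi : w (FImp chi (FB a chi)) -> w chi -> w' chi.
  by move=> h1 h2; apply: R; apply: (mc_mp mw h1 h2).
have Bw phi : w (FB a phi) <-> w' (FB a phi).
  split; first by apply: pull; apply: (mc_thm mw); apply/thm_ax/K45L/ax_4.
  move=> h; apply: contrapT => /(mc_not mw) nB.
  suff /(mc_not mw') : w' (FNot (FB a phi)) by [].
  by apply: pull nB; apply: (mc_thm mw); apply/thm_ax/K45L/ax_5.
split; last by move=> phi /Bw /R.
apply/seteqP; split=> -[p|phi|phi psi|b phi] [h //= e]; split=> //.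
- have [Lp _] := (mc_and K45L mw _ _).1 (mc_thm mw (thm_ax (K45L (ax_Loc e)))).
  exact: pull Lp h.
- by move: h; rewrite e => /Bw.
- have [_ Lp] := (mc_and K45L mw _ _).1 (mc_thm mw (thm_ax (K45L (ax_Loc e)))).
  apply: contrapT => /(mc_not mw) /(pull _ Lp).
  by move/(mc_not mw').
- by move: h; rewrite e => /Bw.
Qed.

Lemma view_inj w w' : mc w -> mc w' -> (forall a, view a w = view a w') -> w = w'.
Proof.
move=> mw mw' ev.
have loc a phi : local_formula a phi -> w phi <-> w' phi.
  move=> l; split=> h.
    by have [] : view a w' phi by rewrite -ev.
  by have [] : view a w phi by rewrite ev.
apply/seteqP; suff H phi : w phi <-> w' phi by split=> phi; apply H.
elim: phi => [p|phi IH|phi IH1 psi IH2|a phi _].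
- exact: (loc (tag p)).
- by rewrite (mc_not mw) (mc_not mw') IH.
- by rewrite (mc_and K45L mw) (mc_and K45L mw') IH1 IH2.
- exact: (loc a).
Qed.

Definition world : Type := {w : set (formula Var) | mc w}.

(** Restricting to views realised by some world is what [canonical_labelP] and
    [canonical_tail_complete] rely on. *)
Definition canonical_vertex : Type :=
  {x : A * set (formula Var) | exists w : world, x.2 = view x.1 (sval w)}.

Definition vertex_of (w : world) (a : A) : {classic canonical_vertex} :=
  exist _ (a, view a (sval w)) (ex_intro _ w erefl).

Definition in_tail (w : world) (a : A) : bool :=
  `[< canonical_rel a (sval w) (sval w) >].

Definition canonical_tail (w : world) : {fset {classic canonical_vertex}} :=
  [fset vertex_of w a | a in A & in_tail w a]%fset.

Definition canonical_head (w : world) : {fset {classic canonical_vertex}} :=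
  [fset vertex_of w a | a in A & ~~ in_tail w a]%fset.

Lemma vertex_ofE w a (x : {classic canonical_vertex}) :
  x = vertex_of w a <-> proj1_sig x = (a, view a (sval w)).
Proof. by split=> [->//|]; case: x => x h /= e; apply: eq_exist. Qed.

Lemma vertex_ofP w w' a b : vertex_of w a = vertex_of w' b <->
  a = b /\ view a (sval w) = view a (sval w').
Proof.
by rewrite vertex_ofE /=; split=> [[-> ->]|[<- ->]].
Qed.

Lemma canonical_disjoint w : fdisjoint (canonical_tail w) (canonical_head w).
Proof.
apply/fdisjointP => x /imfsetP[a /andP[_ ta] ->].
by apply/imfsetP => -[b /andP[_ tb] /vertex_ofP [ab _]]; rewrite -ab ta in tb.
Qed.

Definition canonical_edge (w : world) : hyperedge {classic canonical_vertex} :=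
  Hyperedge (canonical_disjoint w).

Lemma in_support w x :
  x \in support (canonical_edge w) <-> exists a, x = vertex_of w a.
Proof.
rewrite in_fsetU; split=> [/orP[]/imfsetP[a _ ->]|[a ->]]; try by exists a.
case ta: (in_tail w a); apply/orP; [left|right];
  by apply/imfsetP; exists a; rewrite //= inE /= ta.
Qed.

Section Graph.
Variables (w0 : world) (a0 : A).

(** [w0] and [a0] witness that there is a vertex; the edges range over all worlds. *)
Definition canonical_graph : hypergraph :=
  Hypergraph (inhabits (vertex_of w0 a0)) [set E | exists w, E = canonical_edge w].

Definition canonical_color (x : vertex canonical_graph) : A := (sval x).1.

Definition canonical_label (x : vertex canonical_graph) : set (letter Var) :=
  [set p | (sval x).2 (FVar p)].

Lemma canonical_colorP : coloring canonical_color.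
Proof.
move=> _ [w ->] u v /in_support[a ->] /in_support[b ->] + ab.
by rewrite /canonical_color /= in ab; rewrite ab.
Qed.

Lemma canonical_labelP u a : canonical_color u = a ->
  canonical_label u `<=` local_letters a.
Proof.
move=> <- p; rewrite /canonical_label /=.
by have [w ->] := proj2_sig u; case.
Qed.

Definition canonical_model : model Var := Model canonical_colorP canonical_labelP.

(** A vertex carries its color, so inclusion of supports matches the vertices agent by agent; all
    views agree and [view_inj] identifies the worlds. *)
Lemma canonical_simple : simple canonical_graph.
Proof.
move=> _ _ [w ->] [w' ->] + /fsubsetP sub; apply.
have ev a : view a (sval w) = view a (sval w').
  have /sub/in_support[b /vertex_ofP[]] // :
    vertex_of w a \in support (canonical_edge w).
  by apply/in_support; exists a.
case: w w' ev {sub} => [w mw] [w' mw'] ev.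
by congr canonical_edge; apply: eq_exist; apply: view_inj.
Qed.

Lemma canonical_uniform : uniform #|A| canonical_graph.
Proof.
move=> _ [w ->].
have -> : support (canonical_edge w) = [fset vertex_of w a | a in A]%fset.
  apply/fsetP => x; apply/idP/imfsetP => [/in_support[a ->]|[a _ ->]].
    by exists a.
  by apply/in_support; exists a.
rewrite card_imfset /=; last by move=> a b /vertex_ofP[].
by rewrite cardE.
Qed.

(** The argument of type [formula Var] supplies an instance of (D): without letters the language is
    empty. *)
Lemma canonical_tail_complete : (forall a phi, Ax (FNot (FB a (FAnd phi (FNot phi))))) ->
  formula Var -> tail_complete canonical_graph.
Proof.
move=> axD phi; apply/seteqP; split=> // x _.
have [w ex] := proj2_sig x; set a := (proj1_sig x).1 in ex *.
(* If [w] had no successor, [mc_box] would vacuously put a boxed contradiction into [w], against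
   (D). *)
have [w' [mw' R]] : exists w', mc w' /\ canonical_rel a (sval w) w'.
  apply: contrapT => nex.
  have /(mc_not (svalP w)) := mc_thm (svalP w) (thm_ax (axD a phi)); apply.
  by apply/(mc_box K45L (svalP w)) => w' mw' R; case: nex; exists w'.
have [ev Rw'] := (canonical_rel_view a (svalP w) mw').1 R.
exists (canonical_edge (exist _ w' mw')); first by exists (exist _ w' mw').
apply/imfsetP; exists a; first by rewrite inE.
by apply/vertex_ofE; rewrite /= -ev -ex -surjective_pairing.
Qed.

(** A shared vertex of color [a] in the tail of the second edge means equal views and reflexivity at
    [w'], the right-hand side of [canonical_rel_view]. *)
Lemma canonical_accessible a w w' :
  @accessible _ _ canonical_model a (canonical_edge w) (canonical_edge w') <->
  canonical_rel a (sval w) (sval w').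
Proof.
rewrite (canonical_rel_view a (svalP w) (svalP w')); split=> [[u]|[ev R]].
  rewrite in_fsetI => /andP[/in_support[b ->]] /imfsetP[c].
  rewrite inE => R /vertex_ofP [bc ev].
  by move=> <-; split; [exact: ev|rewrite -bc in R].
exists (vertex_of w a) => //; rewrite in_fsetI; apply/andP; split.
  by apply/in_support; exists a.
apply/imfsetP; exists a; first by rewrite inE.
exact/vertex_ofP.
Qed.

Lemma canonical_truth phi w :
  @sat _ _ canonical_model (canonical_edge w) phi <-> sval w phi.
Proof.
elim: phi w => [p|phi IH|phi IH1 psi IH2|a phi IH] w /=.
- split=> [[u /in_support[a ->]] []//|wp].
  (* A letter of [w] is found in the label of its own agent's vertex. *)
  exists (vertex_of w (tag p)); last by split.
  by apply/in_support; exists (tag p).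
- by rewrite IH (mc_not (svalP w)).
- by rewrite IH1 IH2 (mc_and K45L (svalP w)).
- rewrite (mc_box K45L (svalP w)); split=> [H w' mw' R|H _ [w' ->]].
    apply/(IH (exist _ w' mw')); apply: H; first by exists (exist _ w' mw').
    exact/canonical_accessible.
  move=> /canonical_accessible R; apply/IH; exact: H (svalP w') R.
Qed.

End Graph.

(** The world omitting [phi] given by [lindenbaum] yields the refuting edge and also serves as
    [w0]. *)
Lemma canonical_completeness (C : model Var -> Prop) phi :
  0 < #|A| -> (forall w0 a0, C (canonical_model w0 a0)) -> valid C phi -> thm Ax phi.
Proof.
move=> /card_gt0P[a0 _] hC V; apply: contrapT => nphi.
have [|w [mw _ nw]] := @lindenbaum _ _ _ K45L set0 phi.
  by move/ent_set0.
apply: nw; apply/(canonical_truth (exist _ w mw) a0 phi (exist _ w mw)).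
by apply: V (hC _ _) _ _; exists (exist _ w mw).
Qed.

End CanonicalModel.

(** * Soundness over uniform models *)

Section Soundness.
Variables (A : finType) (Var : A -> countType).

Lemma sat_imp (M : model Var) E phi psi :
  @sat _ _ M E (FImp phi psi) <-> (sat E phi -> sat E psi).
Proof.
split=> /= [h h1|h [h1 h2]]; first by apply: contrapT => h2; apply: h; split=> // /(_ h1).
by apply: h1 => /h.
Qed.

Lemma sat_prop_subst (M : model Var) E sigma t :
  @sat _ _ M E (prop_subst sigma t) <-> prop_eval (fun i => `[< sat E (sigma i) >]) t.
Proof.
elim: t => [i|t IH|t1 IH1 t2 IH2] /=.
- by split=> /asboolP.
- by rewrite IH; split=> /negP.
- by rewrite IH1 IH2; split=> /andP.
Qed.

Lemma thm_sound (Ax : formula Var -> Prop) (C : model Var -> Prop) phi :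
  (forall psi, Ax psi -> valid C psi) -> thm Ax phi -> valid C phi.
Proof.
move=> hAx; elim=> [psi /hAx//|psi chi _ h1 _ h2|a psi _ h] M CM E GE.
  by apply: (sat_imp E psi chi).1 (h2 M CM E GE) (h1 M CM E GE).
by move=> E' GE' _; apply: h.
Qed.

Section Uniform.
Variables (M : model Var) (unifM : uniform #|A| (graph M)).
Implicit Types E : hyperedge (vertex (graph M)).

(** The coloring is injective on the support of an edge, which has as many elements as there are
    agents, hence it is bijective there. *)
Lemma vertex_of_color E a : edges E -> exists2 u, u \in support E & color u = a.
Proof.
move=> GE.
have inj : injective (fun u : support E => color (val u)).
  move=> u v euv; apply: val_inj; apply: contrapT => nuv.
  exact: (colorP GE (valP u) (valP v) nuv).
have [|g _ gK] := inj_card_bij inj.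
  by rewrite -cardfE unifM.
by exists (val (g a)); [apply: valP|apply: gK].
Qed.

Lemma color_inj E u v : edges E -> u \in support E -> v \in support E ->
  color u = color v -> u = v.
Proof.
by move=> GE uE vE euv; apply: contrapT => nuv; apply: (colorP GE uE vE nuv).
Qed.

Lemma tail_support E u : u \in tail E -> u \in support E.
Proof. by move=> h; rewrite in_fsetU h. Qed.

Lemma accessible_tail a E E' u : edges E -> u \in support E -> color u = a ->
  accessible a E E' <-> u \in tail E'.
Proof.
move=> GE uE ua; split=> [[v]|h]; last by exists u; rewrite ?in_fsetI ?uE.
rewrite in_fsetI => /andP[vE vE'] va.
by rewrite (color_inj GE uE vE) // ua va.
Qed.

(** By [labelP] only a vertex colored by the agent of [p] can carry [p], and [u] is the only such
    vertex of [E]. *)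
Lemma edge_label_local E u p : edges E -> u \in support E -> color u = tag p ->
  edge_label E p <-> label u p.
Proof.
move=> GE uE up; split=> [[v vE vp]|h]; last by exists u.
rewrite (color_inj GE uE vE) // up.
exact: (labelP (erefl (color v)) vp).
Qed.

Lemma K45L_axiom_sat phi E : K45L_axiom phi -> edges E -> sat E phi.
Proof.
move=> ax GE; case: ax => [t s ht|a psi chi|a psi|a psi|a p pa].
- by apply/sat_prop_subst; apply: ht.
- apply/sat_imp => h1; apply/sat_imp => h2 E' GE' R.
  exact: (sat_imp E' psi chi).1 (h1 E' GE' R) (h2 E' GE' R).
- have [u uE ua] := vertex_of_color a GE.
  (* Lying in the tail of [E'], [u] is also the [a]-vertex of [E'], so the same edges are accessible
     from [E] and from [E']; (5) rests on this too. *)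
  apply/sat_imp => h E' GE' /(accessible_tail _ GE uE ua) uE' E'' GE''.
  move=> /(accessible_tail _ GE' (tail_support uE') ua) uE''.
  by apply: h => //; apply/(accessible_tail _ GE uE ua).
- have [u uE ua] := vertex_of_color a GE.
  apply/sat_imp => h E' GE' /(accessible_tail _ GE uE ua) uE' h'; apply: h.
  move=> E'' GE'' /(accessible_tail _ GE uE ua) uE''.
  by apply: h' => //; apply/(accessible_tail _ GE' (tail_support uE') ua).
- have [u uE ua] := vertex_of_color a GE.
  have up : color u = tag p by rewrite ua pa.
  split; apply/sat_imp => /= h E' GE' /(accessible_tail _ GE uE ua) uE';
    have lE := edge_label_local GE uE up;
    have lE' := edge_label_local GE' (tail_support uE') up; tauto.
Qed.

(** The [a]-vertex of [E] lies in the tail of some edge, which is therefore accessible and would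
    have to satisfy a contradiction. *)
Lemma D_sat a phi E : tail_complete (graph M) -> edges E ->
  sat E (FNot (FB a (FAnd phi (FNot phi)))).
Proof.
move=> tc GE /= h; have [u uE ua] := vertex_of_color a GE.
have : [set: vertex (graph M)] u by [].
rewrite tc => -[E' GE' uE'].
by have [] := h E' GE' ((accessible_tail _ GE uE ua).2 uE').
Qed.

End Uniform.

End Soundness.

Theorem theorem3 (n : nat) (A : finType) (Var : A -> countType)
    (hn : 1 <= n) (hA : #|A| = n) :
  forall phi : formula Var,
    (provable (@K45L_axiom A Var) phi <-> valid (@Hsu A Var n) phi) /\
    (provable (@KD45L_axiom A Var) phi <-> valid (@Hsut A Var n) phi).
Proof.
move=> phi; subst n; split; rewrite provableE; split.
- by apply: thm_sound => psi ax M [_ uM] E; apply: K45L_axiom_sat.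
- apply: canonical_completeness => // w0 a0.
  by split; [apply: canonical_simple|apply: canonical_uniform].
- apply: thm_sound => psi ax M [_ uM tM] E GE.
  case: ax => [chi ax|a chi]; first exact: K45L_axiom_sat.
  exact: D_sat.
- apply: canonical_completeness => // [psi|w0 a0]; first exact: ax_K45L.
  split; [by apply: canonical_simple; exact: ax_K45L|exact: canonical_uniform|].
  by apply: canonical_tail_complete => // [psi|a psi]; [exact: ax_K45L|exact: ax_D].
Qed.
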